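(* Let $\mathcal{G}=(\mathcal{V},\mathcal{E})$ be a strongly connected digraph and let $\{\mathbf{y}(k)=(y_i(k))_{i=1}^N\}_{k\in\mathbb{Z}_+}$ be generated by the distributed quantized average consensus and weight-balancing algorithm described in the context, where: the step-size $\gamma(k)=2^{-n}$ for $2^n-1\le k\le 2^{n+1}-2$, $n\in\mathbb{Z}_+$; the average $\bar{y}(0)=\frac1N\sum_{i=1}^N y_i(0)$ satisfies $\bar y(0)\in[q_{\min},q_{\max}]$; and the step-size $\{\alpha(k)\}$ satisfies $\alpha(k)>0$, $\alpha(k+1)\le\alpha(k)$ for all $k$, $\sum_{k\ge1}\alpha(k)=\infty$ and $\sum_{k\ge1}\alpha(k)^2<\infty$. Then (a) $\mathbb{P}\left(\lim_{k\to\infty}\mathbf{y}(k)=\bar y(0)\mathbf{1}\right)=1$, and (b) $\lim_{k\to\infty}\mathbb{E}\left[\Vert\mathbf{y}(k)-\bar y(0)\mathbf{1}\Vert^2\right]=0$.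
   Context: $\mathcal{G}=(\mathcal{V},\mathcal{E})$, $\mathcal{V}=\{1,\dots,N\}$, is a directed graph without self-loops; in-neighbors $\mathcal{N}_i^-=\{j:(j,i)\in\mathcal{E}\}$, out-neighbors $\mathcal{N}_i^+=\{j:(i,j)\in\mathcal{E}\}$, $d_i^+=|\mathcal{N}_i^+|$. Strongly connected: directed path between every ordered pair of nodes. Algorithm: given $q_{\min}<q_{\max}$, arbitrary real initial values $y_i(0)$, initialize $a_{ij}(0)=1$ if $j\in\mathcal{N}_i^-$ and $0$ otherwise. At iteration $k$, let $b_i(k)=\sum_{j\in\mathcal{N}_i^-}a_{ij}(k)-\sum_{j\in\mathcal{N}_i^+}a_{ji}(k)$. Each node $i$ broadcasts to its out-neighbors $n_i(k)=\mathcal{I}\{b_i(k)\ge d_i^+\gamma(k)\}$ and a random $x_i(k)$ which equals $q_{\max}$ with probability $p_i(k)=\frac{\tilde y_i(k)-q_{\min}}{q_{\max}-q_{\min}}$ and $q_{\min}$ with probability $1-p_i(k)$, where $\tilde y_i(k)=\min\{\max\{y_i(k),q_{\min}\},q_{\max}\}$. Then node $i$ updates $a_{ij}(k+1)=a_{ij}(k)+n_j(k)\gamma(k)$ for $j\in\mathcal{N}_i^-$ and $y_i(k+1)=y_i(k)+\alpha(k)\sum_{j\in\mathcal{N}_i^-}a_{ij}(k)\big(x_j(k)-x_i(k)\big)+\alpha(k)b_i(k)x_i(k)$. *)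

(* Defs.v *)
From HB Require Import structures.
From mathcomp Require Import all_boot all_order all_algebra.
From mathcomp Require Import all_classical all_reals all_analysis.
Set Implicit Arguments. Unset Strict Implicit. Unset Printing Implicit Defensive.
Import Order.TTheory GRing.Theory Num.Theory.
Import numFieldNormedType.Exports.
Local Open Scope classical_set_scope.
Local Open Scope ring_scope.

(* Graph convention: E : rel 'I_N, [E j i] means (j,i) is an edge of the digraph
   (j is an in-neighbour of i, i is an out-neighbour of j). *)

Section Algo.
Variables (R : realType) (N : nat) (E : rel 'I_N) (gamma : nat -> R).

Definition outdeg (i : 'I_N) : R := (#|[set j | E i j]|)%:R.

Definition bal (a : 'I_N -> 'I_N -> R) (i : 'I_N) : R :=
  \sum_(j | E j i) a i j - \sum_(j | E i j) a j i.

Definition nflag (a : 'I_N -> 'I_N -> R) (k : nat) (i : 'I_N) : R :=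
  if outdeg i * gamma k <= bal a i then 1 else 0.

Fixpoint weights (k : nat) : 'I_N -> 'I_N -> R :=
  match k with
  | 0 => fun i j => if E j i then 1 else 0
  | k'.+1 => let a := weights k' in
      fun i j => if E j i then a i j + nflag a k' j * gamma k' else 0
  end.

Variables (alpha : nat -> R) (qmin qmax : R).

Definition clampq (v : R) : R := Num.min (Num.max v qmin) qmax.

Definition probq (v : R) : R := (clampq v - qmin) / (qmax - qmin).

(* The random broadcast x_i(k) is realized from an auxiliary uniform variable u:
   x = qmax if u < p, qmin otherwise, so that P(x = qmax | past) = p. *)
Definition quant (v u : R) : R := if u < probq v then qmax else qmin.

(* trajectory y(k) along a fixed sample path of the driving uniforms u i k *)
Fixpoint traj (y0 : 'I_N -> R) (u : 'I_N -> nat -> R) (k : nat) : 'I_N -> R :=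
  match k with
  | 0 => y0
  | k'.+1 => let y := traj y0 u k' in
      let x := fun i => quant (y i) (u i k') in
      let a := weights k' in
      fun i => y i + alpha k' * (\sum_(j | E j i) a i j * (x j - x i))
                   + alpha k' * bal a i * x i
  end.

End Algo.

Definition avg (R : realType) (N : nat) (v : 'I_N -> R) : R :=
  (\sum_i v i) / N%:R.

Definition uniform01 d (T : measurableType d) (R : realType)
  (P : probability T R) (U : T -> R) : Prop :=
  measurable_fun setT U /\
  forall t : R, 0 <= t <= 1 -> P [set w | U w < t] = t%:E.

Definition mutually_independent d (T : measurableType d) (R : realType)
  (P : probability T R) (I : eqType) (X : I -> T -> R) : Prop :=
  forall (s : seq I) (B : I -> set R), uniq s ->
    (forall j, j \in s -> measurable (B j)) ->
    P (\bigcap_(j in [set j | j \in s]) (X j @^-1` B j)) =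
      (\prod_(j <- s) P (X j @^-1` B j))%E.

(* Main.v *)
(* Weight balancing.  A node with negative imbalance has never fired, and the
   mass fired by an in-neighbour of j is controlled by the mass fired by j, so by
   strong connectivity the total fired mass is bounded.  A stage without an idle
   step fires mass at least 1, so almost every stage has an idle step, at which
   all imbalances are O(gamma(k)); their negative part never increases, hence the
   imbalance is O(gamma(k)) = O(1/k) and alpha(k) times it is summable.

   Consensus.  The update preserves the sum of y, whatever the weights, and since
   saturated nodes are pulled back, y stays deterministically bounded.  With z the
   deviation of y from the average and D the sum over the edges of the squared
   differences of the clamped values, the conditional drift of |z|^2 is at most
   -alpha D plus a summable error, and |z|^2 <= C D because z has zero sum and the
   average lies in [qmin, qmax].  So E|z|^2 tends to 0, and Ville's maximal
   inequality applied to |z|^2, up to the tail of the errors, turns this into almost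
   sure convergence.

   A run is determined by finitely many bits per step, so expectations up to time k
   are finite sums over the tree of bit histories. *)
Require Import Defs.
From HB Require Import structures.
From mathcomp Require Import all_boot all_order all_algebra.
From mathcomp Require Import all_classical all_reals all_analysis.
From mathcomp Require Import measurable_realfun ring lra zify.
Import Order.TTheory GRing.Theory Num.Theory.
Import numFieldNormedType.Exports.
Set Implicit Arguments. Unset Strict Implicit. Unset Printing Implicit Defensive.
Local Open Scope classical_set_scope.
Local Open Scope ring_scope.

(** The length bound makes the constants accumulated along a path depend on the number of vertices
    only. *)
Lemma connect_uniq_path (T : finType) (e : rel T) (x y : T) : connect e x y ->
  exists2 p : seq T, path e x p & y = last x p /\ (size p <= #|T|)%N.
Proof.
move=> /connectP[p ep ->]; case: (shortenP ep) => q eq /= uq _.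
exists q => //; split=> //; have := max_card (mem q); rewrite (card_uniqP _) //.
by case/andP: uq.
Qed.

(** * Weight balancing *)

Section WeightBalancing.
Variables (R : realType) (N : nat) (E : rel 'I_N) (gamma : nat -> R).
Hypothesis gamma_gt0 : forall k, 0 < gamma k.
Hypothesis E_conn : forall i j : 'I_N, connect E i j.
Hypothesis E_out : forall i : 'I_N, exists j, E i j.

Let a k := weights E gamma k.
Let b k i := bal E (a k) i.
Let flag k i := nflag E gamma (a k) k i.

(** All edges out of [j] carry the same weight, so this one number per node determines the weight
    matrix. *)
Definition fired k (j : 'I_N) : R := \sum_(t < k) flag t j * gamma t.

Lemma weights_fired k i j : E j i -> weights E gamma k i j = 1 + fired k j.
Proof.
move=> Eji; rewrite /fired; elim: k => [|k IHk] /=; first by rewrite Eji big_ord0 addr0.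
by rewrite Eji IHk big_ord_recr /= addrA.
Qed.

Lemma nflag_ge0 (v : 'I_N -> 'I_N -> R) k i : 0 <= nflag E gamma v k i.
Proof. by rewrite /nflag; case: ifP. Qed.

Lemma firedS k j : fired k.+1 j = fired k j + flag k j * gamma k.
Proof. by rewrite /fired big_ord_recr. Qed.

Lemma fired_ge0 k j : 0 <= fired k j.
Proof. by apply: sumr_ge0 => t _; rewrite mulr_ge0 ?nflag_ge0 // ltW. Qed.

Lemma outdegE (i : 'I_N) (c : R) : \sum_(j | E i j) c = outdeg R E i * c.
Proof.
rewrite sumr_const /outdeg mulr_natl; congr (c *+ _).
by apply: eq_card => j; rewrite [RHS]inE; apply/idP/asboolP.
Qed.

Lemma outdeg_ge1 i : 1 <= outdeg R E i.
Proof.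
have [j Eij] := E_out i; rewrite -[outdeg _ _ _]mulr1 -outdegE (bigD1 j) //=.
by rewrite lerDl sumr_ge0.
Qed.

Lemma outdeg_leN i : outdeg R E i <= N%:R.
Proof.
rewrite -[outdeg _ _ _]mulr1 -outdegE -[N in N%:R]card_ord -sum1_card natr_sum.
by rewrite [leRHS](bigID (E i)) /= lerDl sumr_ge0.
Qed.

Lemma bal_fired k i :
  b k i = \sum_(j | E j i) (1 + fired k j) - outdeg R E i * (1 + fired k i).
Proof.
rewrite /b /bal /a (eq_bigr (fun j => 1 + fired k j)); last first.
  by move=> j; apply: weights_fired.
rewrite [X in _ - X](eq_bigr (fun=> 1 + fired k i)) ?outdegE //.
by move=> j; apply: weights_fired.
Qed.

Lemma balS k i : b k.+1 i =
  b k i + (\sum_(j | E j i) flag k j * gamma k - outdeg R E i * (flag k i * gamma k)).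
Proof.
rewrite !bal_fired (eq_bigr (fun j => (1 + fired k j) + flag k j * gamma k)).
  by rewrite big_split /= firedS; lra.
by move=> j _; rewrite firedS addrA.
Qed.

Lemma bal_sum0 (v : 'I_N -> 'I_N -> R) : \sum_i bal E v i = 0.
Proof.
rewrite /bal big_split /= sumrN (exchange_big_dep predT) //=.
by rewrite subrr.
Qed.

(** Since the imbalances sum to zero, this is half of their l1 norm and dominates each of them;
    negative parts are chosen because they never increase, node by node. *)
Definition deficit k : R := \sum_i Num.max (- b k i) 0.

Lemma deficit_ge0 k : 0 <= deficit k.
Proof. by apply: sumr_ge0 => i _; rewrite le_max lexx orbT. Qed.

Lemma deficit_pos k : deficit k = \sum_i Num.max (b k i) 0.
Proof.
apply/eqP; rewrite -subr_eq0 /deficit -sumrB (eq_bigr (fun i => - b k i)).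
  by rewrite sumrN bal_sum0 oppr0.
by move=> i _; case: (leP (- b k i)); case: (leP (b k i)); lra.
Qed.

Lemma norm_bal_le k i : `|b k i| <= deficit k.
Proof.
have maxsum (f : 'I_N -> R) : f i <= \sum_j Num.max (f j) 0.
  rewrite (bigD1 i) //= -[leLHS]addr0; apply: lerD; first by rewrite le_max lexx.
  by apply: sumr_ge0 => j _; rewrite le_max lexx orbT.
by rewrite ler_norml {2}deficit_pos maxsum andbT lerNl; apply: maxsum.
Qed.

Lemma inflow_ge0 k i : 0 <= \sum_(j | E j i) flag k j * gamma k.
Proof. by apply: sumr_ge0 => j _; rewrite mulr_ge0 ?nflag_ge0 // ltW. Qed.

(* A node that fires keeps a nonnegative imbalance, a node that does not fire
   can only gain. *)
Lemma deficitS k : deficit k.+1 <= deficit k.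
Proof.
apply: ler_sum => i _; have := inflow_ge0 k i; rewrite balS.
set s := \sum_(j | _) _ => s0; rewrite ge_max !le_max lexx orbT andbT.
rewrite /flag /nflag -/(b k i); case: ifP => [le_b|_].
  by apply/orP; right; lra.
by apply/orP; left; lra.
Qed.

Lemma deficit_le m n : (m <= n)%N -> deficit n <= deficit m.
Proof.
move=> /subnKC <-; elim: (n - m)%N => [|p IHp]; rewrite ?addn0 // addnS.
exact: le_trans (deficitS _) IHp.
Qed.

(** The first firing requires a nonnegative imbalance, and no later step destroys it: a firing costs
    [outdeg i * gamma k], which the threshold guarantees to be available. *)
Lemma bal_lt0_fired0 k i : b k i < 0 -> fired k i = 0.
Proof.
suff: fired k i = 0 \/ 0 <= b k i by case=> // b0 /(le_lt_trans b0); rewrite ltxx.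
elim: k => [|k IHk]; first by left; rewrite /fired big_ord0.
have := inflow_ge0 k i; rewrite firedS balS; set s := \sum_(j | _) _ => s0.
rewrite /flag /nflag -/(b k i); case: ifP => [le_b|_]; first by right; lra.
by case: IHk => ?; [left | right]; lra.
Qed.

(** Either some node has a negative imbalance, hence has never fired, and a path to it bounds the
    mass fired by any node; or all imbalances vanish and nothing fires. *)
Lemma fired_bounded : exists2 M : R, 0 <= M & forall k j, fired k j <= M.
Proof.
pose D := deficit 0.
have D0 : 0 <= D := deficit_ge0 0.
(* [g n] will bound the mass fired by a node with a path of length [n] to a node that has never
   fired; the recursion is that of [back]. *)
pose g := fix g n : R := if n is n'.+1 then 2 * D + N%:R * g n' else 0.
have g0 n : 0 <= g n.
  by elim: n => //= n IHn; rewrite addr_ge0 // mulr_ge0.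
pose G := \sum_(n < N.+1) g n.
have G0 : 0 <= G by apply: sumr_ge0.
have gG n : (n <= N)%N -> g n <= G.
  rewrite -ltnS => ltn; rewrite /G (bigD1 (Ordinal ltn)) //= lerDl.
  by apply: sumr_ge0.
(* [G] bounds the mass before the current step, and [D] bounds what one firing adds, since [gamma k]
   is at most the imbalance of a firing node. *)
exists (G + D); first exact: addr_ge0.
(* The mass fired by an in-neighbour of j is controlled by that fired by j. *)
have back k j l : E l j -> fired k l <= 2 * D + N%:R * fired k j.
  (* Subtracting the identities at times [k] and 0 cancels the degrees; each of the two imbalances
     costs at most [D]. *)
  move=> Elj; have := bal_fired k j; have := bal_fired 0 j.
  rewrite !big_split /=; have f0 l' : fired 0 l' = 0 by rewrite /fired big_ord0.
  rewrite [\sum_(_ | E _ j) fired 0 _]big1 // f0.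
  have := fired_ge0 k j; have := outdeg_leN j.
  have := le_trans (norm_bal_le k j) (deficit_le (leq0n k)); rewrite ler_norml -/D.
  have := norm_bal_le 0 j; rewrite ler_norml -/D => /andP[? ?] /andP[? ?].
  have : fired k l <= \sum_(l' | E l' j) fired k l'.
    rewrite (bigD1 l) //= lerDl sumr_ge0 // => ? _; exact: fired_ge0.
  by move=> ? ? ? ? ?; nra.
have along k p : forall i, path E i p -> fired k (last i p) = 0 ->
    fired k i <= g (size p).
  elim: p => [|j p IHp] i /=; first by move=> _ ->.
  move=> /andP[Eij pp] /(IHp _ pp) le_j; apply: (le_trans (back _ _ _ Eij)).
  by rewrite lerD2l ler_wpM2l.
have idle k i j : fired k i = 0 -> fired k j <= G.
  move=> fi; have [p pp [lp]] := connect_uniq_path (E_conn j i).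
  rewrite card_ord => sp; apply: le_trans (gG _ sp); apply: along => //.
  by rewrite -lp.
elim=> [j|k IHk j]; first by rewrite /fired big_ord0 addr_ge0.
rewrite firedS; have [[i bi]|b0] := pselect (exists i, b k i < 0).
  rewrite lerD ?(idle _ _ _ (bal_lt0_fired0 bi)) // /flag /nflag -/(b k j).
  case: ifP; rewrite ?mul0r // mul1r => le_b.
  have := le_trans (norm_bal_le k j) (deficit_le (leq0n k)); rewrite ler_norml -/D.
  by have := outdeg_ge1 j; have := gamma_gt0 k; move=> ? ? /andP[_ ?]; nra.
(* Without a negative imbalance the zero sum makes every imbalance vanish, and the positive
   threshold then forbids firing. *)
suff -> : flag k j = 0 by rewrite mul0r addr0.
have d0 : deficit k = 0.
  rewrite /deficit big1 // => i _; apply/max_idPr; rewrite oppr_le0 leNgt.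
  by apply/negP => bi; apply: b0; exists i.
have := norm_bal_le k j; rewrite d0 normr_le0 => /eqP bj.
rewrite /flag /nflag -/(b k j) bj; case: ifP => //.
by have := outdeg_ge1 j; have := gamma_gt0 k; nra.
Qed.

(** When nobody fires, every imbalance is below its threshold [outdeg i * gamma k]; the deficit is
    also the sum of the positive parts. *)
Lemma deficit_idle k : (forall i, flag k i = 0) -> deficit k <= N%:R ^+ 2 * gamma k.
Proof.
move=> fl; rewrite deficit_pos expr2 -mulrA -[X in X%:R * _]card_ord -sum1_card.
rewrite natr_sum mulr_suml; apply: ler_sum => i _; rewrite mul1r ge_max.
have g0 := gamma_gt0 k; have dN := outdeg_leN i; have d1 := outdeg_ge1 i.
apply/andP; split; last by nra.
have := fl i; rewrite /flag /nflag -/(b k i); case: ifP => [_|/negbT].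
  by move/eqP; rewrite oner_eq0.
by rewrite -ltNge; nra.
Qed.

Definition fired_total k : R := \sum_j fired k j.

Lemma fired_totalS k i : flag k i != 0 -> fired_total k + gamma k <= fired_total k.+1.
Proof.
move=> fi; rewrite /fired_total (bigD1 i) //= [leRHS](bigD1 i) //= firedS.
have -> : flag k i = 1 by move: fi; rewrite /flag /nflag; case: ifP; rewrite ?eqxx.
have : \sum_(j | j != i) fired k j <= \sum_(j | j != i) fired k.+1 j.
  apply: ler_sum => j _; rewrite firedS lerDl mulr_ge0 ?nflag_ge0 //.
  exact/ltW.
by lra.
Qed.

Lemma fired_total_le m n : (m <= n)%N -> fired_total m <= fired_total n.
Proof.
move=> /subnKC <-; elim: (n - m)%N => [|p IHp]; rewrite ?addn0 // addnS.
apply: le_trans IHp _; apply: ler_sum => j _.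
by rewrite firedS lerDl mulr_ge0 ?nflag_ge0 ?ltW.
Qed.

(** * Stages of constant step-size and the decay rate of the imbalance *)

Hypothesis gamma_stage : forall n k : nat, (2 ^ n - 1 <= k <= 2 ^ n.+1 - 2)%N ->
  gamma k = (2 ^+ n)^-1.

(* A stage during which every step sees a firing increases the total fired mass
   by at least 1. *)
Lemma busy_stage n :
  (forall k, (2 ^ n - 1 <= k <= 2 ^ n.+1 - 2)%N -> exists i, flag k i != 0) ->
  fired_total (2 ^ n - 1) + 1 <= fired_total (2 ^ n.+1 - 1).
Proof.
move=> busy; have n0 : (0 < 2 ^ n)%N by rewrite expn_gt0.
suff H p : (p <= 2 ^ n)%N ->
    fired_total (2 ^ n - 1) + p%:R * (2 ^+ n)^-1 <= fired_total (2 ^ n - 1 + p).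
  have := H _ (leqnn _); rewrite natrX divff ?expf_neq0 ?pnatr_eq0 //.
  by congr (_ <= fired_total _); rewrite expnS; lia.
elim: p => [|p IHp] lp; first by rewrite mul0r !addr0 addn0.
have kin : (2 ^ n - 1 <= 2 ^ n - 1 + p <= 2 ^ n.+1 - 2)%N.
  by rewrite expnS; lia.
have [i /fired_totalS] := busy _ kin; rewrite (gamma_stage kin) addnS.
by apply: le_trans; have := IHp (ltnW lp); rewrite -natr1; lra.
Qed.

(** The stage of [k] is the integer part of the binary logarithm of [k.+1]. *)
Lemma stageP k : exists n, (2 ^ n - 1 <= k <= 2 ^ n.+1 - 2)%N.
Proof.
exists (trunc_log 2 k.+1); have := trunc_log_bounds (isT : (1 < 2)%N) (isT : (0 < k.+1)%N).
by move=> /andP[]; lia.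
Qed.

Lemma gamma_le k : gamma k <= 2 / k.+1%:R.
Proof.
have [n kn] := stageP k; rewrite (gamma_stage kn) ler_pdivlMr ?ltr0n //.
rewrite mulrC ler_pdivrMr ?exprn_gt0 // -exprS -natrX ler_nat.
by move: kn => /andP[_]; have := expn_gt0 2 n.+1; lia.
Qed.

Lemma deficit_gamma : exists2 C : R, 0 <= C & forall k, deficit k <= C * gamma k.
Proof.
have [M M0 leM] := fired_bounded.
pose A := [set fired_total k | k in setT].
have hsA : has_sup A.
  split; first by exists (fired_total 0), 0%N.
  exists (\sum_(j < N) M) => _ [k _ <-]; exact: ler_sum.
(* From [k0] on less than 1 of fired mass remains to be spent, so no later stage can be busy
   throughout. *)
have [_ [k0 _ <-] sup_lt] := sup_adherent ltr01 hsA.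
have busyN n : (k0 <= 2 ^ n - 1)%N -> exists2 k,
    (2 ^ n - 1 <= k <= 2 ^ n.+1 - 2)%N & deficit k <= N%:R ^+ 2 * gamma k.
  move=> le_k0; apply: contrapT => nex.
  suff /busy_stage : forall k, (2 ^ n - 1 <= k <= 2 ^ n.+1 - 2)%N ->
      exists i, flag k i != 0.
    have := fired_total_le le_k0.
    have : fired_total (2 ^ n.+1 - 1) <= sup A.
      by apply: ub_le_sup; [exact: hsA.2 | exists (2 ^ n.+1 - 1)%N].
    by lra.
  move=> k kn; apply: contrapT => nfl; apply: nex; exists k => //.
  apply: deficit_idle => i; apply: contrapT => /eqP fi; apply: nfl.
  by exists i.
(* Before [K] the initial deficit suffices, [gamma] being at least [(2 ^+ k0.+2)^-1]. From [K] on,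
   the stage preceding that of [k] starts no earlier than [k0], so it has an idle step, and [gamma]
   has halved since: hence the factor 2 in the constant. *)
pose K := (2 ^ k0.+2)%N.
have gammaK k : (k < K)%N -> (2 ^+ k0.+2)^-1 <= gamma k.
  move=> kK; have [n kn] := stageP k; rewrite (gamma_stage kn).
  rewrite lef_pV2 ?posrE ?exprn_gt0 // ler_eXn2l ?ltr1n //.
  rewrite -ltnS -(ltn_exp2l _ _ (isT : (1 < 2)%N)) !expnS.
  by move: kn kK; rewrite /K !expnS; lia.
exists (deficit 0 * 2 ^+ k0.+2 + 2 * N%:R ^+ 2).
  by apply: addr_ge0; rewrite mulr_ge0 ?exprn_ge0 ?ler0n //; apply: deficit_ge0.
move=> k; have g0 := gamma_gt0 k; rewrite mulrDl; have [kK|Kk] := ltnP k K.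
  rewrite (le_trans (deficit_le (leq0n k))) // -[leLHS]addr0 lerD //; last first.
    by rewrite !mulr_ge0 ?exprn_ge0 ?ler0n // ltW.
  rewrite -mulrA ler_peMr ?deficit_ge0 // -ler_pdivrMl ?exprn_gt0 // mulr1.
  exact: gammaK.
rewrite -[leLHS]add0r lerD //.
  by apply: mulr_ge0 (ltW g0); rewrite mulr_ge0 ?exprn_ge0 ?ler0n //; apply: deficit_ge0.
have [[|n] kn] := stageP k.
  by move: kn Kk; rewrite /K !expnS; have := expn_gt0 2 k0; lia.
have le_k0 : (k0 <= 2 ^ n - 1)%N.
  have : (k0.+1 < n.+1)%N.
    rewrite -(ltn_exp2l _ _ (isT : (1 < 2)%N)).
    by move: kn Kk; rewrite /K !expnS; have := expn_gt0 2 k0; lia.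
  by have := ltn_expl n (isT : (1 < 2)%N); lia.
have [j jn dj] := busyN _ le_k0.
apply: (le_trans (deficit_le (_ : (j <= k)%N))).
  by move: jn kn; rewrite !expnS; lia.
apply: le_trans dj _; rewrite (gamma_stage jn) (gamma_stage kn).
rewrite (exprS 2 n) invfM; have : 0 <= (2 ^+ n : R)^-1 by rewrite invr_ge0 exprn_ge0.
by move: (_^-1) => t t0; lra.
Qed.

End WeightBalancing.

(** * Drift of the squared deviation *)

Section Drift.
Variables (R : realType) (N : nat) (E : rel 'I_N).
Implicit Types (a : 'I_N -> 'I_N -> R) (x y z t : 'I_N -> R).

Definition flow a x i : R :=
  \sum_(j | E j i) a i j * (x j - x i) + bal E a i * x i.

(** The imbalance term replaces the in-weights of [i] by its out-weights in front of [x i]. This is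
    a conservation form: what leaves [i] enters its out-neighbours, balanced or not. *)
Lemma flowE a x i :
  flow a x i = \sum_(j | E j i) a i j * x j - (\sum_(j | E i j) a j i) * x i.
Proof.
rewrite /flow /bal; under eq_bigr do rewrite mulrBr.
by rewrite sumrB -mulr_suml; ring.
Qed.

Lemma flow_sum0 a x : \sum_i flow a x i = 0.
Proof.
under eq_bigr do rewrite flowE mulr_suml.
rewrite sumrB (exchange_big_dep predT) //=; apply/eqP; rewrite subr_eq0.
by apply/eqP/eq_bigr => i _; apply: eq_bigr.
Qed.

Lemma flow_mean (I : finType) (r : I -> R) (x : I -> 'I_N -> R) a i :
  \sum_k r k * flow a (x k) i = flow a (fun j => \sum_k r k * x k j) i.
Proof.
under eq_bigr do rewrite flowE mulrBr mulr_sumr.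
rewrite sumrB flowE exchange_big /= mulr_sumr; congr (_ - _).
  by apply: eq_bigr => j _; rewrite mulr_sumr; apply: eq_bigr => k _; ring.
by apply: eq_bigr => k _; ring.
Qed.

Lemma norm_sum_edges_le (f : 'I_N -> R) (i : 'I_N) (c : R) : 0 <= c ->
  (forall j, E j i -> `|f j| <= c) -> `|\sum_(j | E j i) f j| <= N%:R * c.
Proof.
move=> c0 fc; apply: le_trans (ler_norm_sum _ _ _) _.
apply: le_trans (_ : \sum_(j < N) c <= _); last first.
  by rewrite sumr_const card_ord mulr_natl.
rewrite [leRHS](bigID (fun j => E j i)) /= -[leLHS]addr0; apply: lerD.
  exact: ler_sum.
exact: sumr_ge0.
Qed.

Lemma norm_flow_le a x i (A Q delta : R) : 0 <= A -> 0 <= Q ->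
  (forall j, E j i -> `|a i j| <= A) -> (forall j, `|x j| <= Q) ->
  `|bal E a i| <= delta ->
  `|flow a x i| <= N%:R * (A * (Q + Q)) + delta * Q.
Proof.
move=> A0 Q0 aA xQ bd; apply: le_trans (ler_normD _ _) _; apply: lerD; last first.
  by rewrite normrM ler_pM.
apply: norm_sum_edges_le => [|j Eji]; first by rewrite mulr_ge0 ?addr_ge0.
rewrite normrM ler_pM ?aA //.
exact: le_trans (ler_normB _ _) (lerD (xQ j) (xQ i)).
Qed.

Variables (qmin qmax : R).
Hypothesis hq : qmin < qmax.

Lemma clampq_bounds (v : R) : qmin <= clampq qmin qmax v <= qmax.
Proof. by rewrite /clampq ge_min le_min le_max !lexx !orbT (ltW hq). Qed.

Lemma clampq_le (v m : R) : qmin <= m -> v <= m -> clampq qmin qmax v <= m.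
Proof. by move=> qm vm; rewrite /clampq ge_min ge_max qm vm. Qed.

Lemma clampq_ge (v m : R) : m <= qmax -> m <= v -> m <= clampq qmin qmax v.
Proof. by move=> qm vm; rewrite /clampq le_min le_max qm vm. Qed.

(** Variational inequality of the projection onto the interval. *)
Lemma clampq_proj (v c : R) : qmin <= c <= qmax ->
  (v - clampq qmin qmax v) * (c - clampq qmin qmax v) <= 0.
Proof.
move=> /andP[qc cq]; rewrite /clampq minElt maxElt.
by case: ifP => [?|/negbT]; case: ifP => [?|/negbT]; rewrite -?leNgt; nra.
Qed.

Definition sqdev m y : R := \sum_i (y i - m) ^+ 2.

Definition edge_energy t : R := \sum_i \sum_(j | E j i) (t j - t i) ^+ 2.

Local Notation cl y := (fun i => clampq qmin qmax (y i)).

(** The weights need not be balanced: the defect only enters through terms of order [delta], and the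
    gap between [y] and its clamped value has a favourable sign. *)
Lemma drift_le a y (m delta B Q : R) : qmin <= m <= qmax ->
  0 <= B -> 0 <= Q -> `|qmin| <= Q -> `|qmax| <= Q ->
  (forall i j, E j i -> 1 <= a i j) -> (forall i, `|bal E a i| <= delta) ->
  (forall i, `|y i - m| <= B) ->
  \sum_i (y i - m) * flow a (cl y) i <=
    - (edge_energy (cl y) / 2) + N%:R * (delta * (2 * Q ^+ 2 + B * Q)).
Proof.
move=> /andP[qm mq] B0 Q0 Qmin Qmax a1 bd yB.
have cQ (v : R) : `|clampq qmin qmax v| <= Q.
  move: Qmin Qmax (clampq_bounds v); rewrite !ler_norml.
  by move=> /andP[? ?] /andP[? ?] /andP[? ?]; apply/andP; split; lra.
pose c i := clampq qmin qmax (y i); pose t i := c i - m.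
(* Half the flow of the squares [t i ^+ 2] is subtracted for free, as every flow sums to zero; it
   completes the squares edge by edge. *)
apply: le_trans (_ : \sum_i (y i - m) * flow a (cl y) i
    - \sum_i flow a (fun i => t i ^+ 2) i / 2 <= _).
  by rewrite -mulr_suml flow_sum0; lra.
rewrite -sumrB.
apply: le_trans (_ : \sum_i ((- (\sum_(j | E j i) (c j - c i) ^+ 2) / 2)
    + delta * (2 * Q ^+ 2 + B * Q)) <= _); last first.
  by rewrite big_split /= sumr_const card_ord -[_ *+ N]mulr_natl -mulr_suml sumrN mulNr.
apply: ler_sum => i _; rewrite /flow -/(c i).
(* Each edge yields [a'] times a projection term minus half a square; both contributions are
   nonpositive, so [1 <= a'] gives the bound. *)
have edge : (y i - m) * (\sum_(j | E j i) a i j * (c j - c i))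
    - (\sum_(j | E j i) a i j * (t j ^+ 2 - t i ^+ 2)) / 2
    <= - (\sum_(j | E j i) (c j - c i) ^+ 2) / 2.
  rewrite -sumrN mulr_sumr !mulr_suml -sumrB; apply: ler_sum => j Eji.
  have := clampq_proj (y i) (clampq_bounds (y j)); rewrite -/(c i) -/(c j) /t.
  have := a1 i j Eji; move: (a i j) (y i) (c i) (c j) => a' y' ci cj a1' pr.
  have -> : (y' - m) * (a' * (cj - ci)) - a' * ((cj - m) ^+ 2 - (ci - m) ^+ 2) / 2
    = a' * ((y' - ci) * (cj - ci)) - a' * ((cj - ci) ^+ 2 / 2) by field.
  have := sqr_ge0 (cj - ci); move: pr; move: (_ * (cj - ci)) (_ ^+ 2) => p s.
  by move=> ? ?; nra.
have tQ : t i ^+ 2 <= 4 * Q ^+ 2.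
  have : `|m| <= Q.
    by move: Qmin Qmax; rewrite !ler_norml => /andP[? ?] /andP[? ?];
       apply/andP; split; lra.
  move=> mQ; have -> : 4 * Q ^+ 2 = (Q + Q) ^+ 2 by ring.
  rewrite -(real_normK (num_real (t i))) ler_sqr ?nnegrE ?addr_ge0 //.
  by apply: le_trans (ler_normB _ _) _; apply: lerD => //; apply: cQ.
(* The two imbalance terms, this one counted by half, make up the constant [2 * Q ^+ 2 + B * Q]. *)
have b1 : - (bal E a i * t i ^+ 2) <= delta * (4 * Q ^+ 2).
  apply: le_trans (ler_norm _) _; rewrite normrN normrM ler_pM //.
  by rewrite ger0_norm ?sqr_ge0.
have b2 : bal E a i * ((y i - m) * c i) <= delta * (B * Q).
  apply: le_trans (ler_norm _) _; rewrite normrM ler_pM // normrM ler_pM //.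
  exact: cQ.
by lra.
Qed.

(** By the zero sum some [z j] is nonpositive, so every [t i] is at most [s]; this bounds [z] from
    above, and the zero sum converts it into a bound from below. It is used with [z] the deviations
    and [t] the clamped ones, up to sign. *)
Lemma one_sided_bound z t (K s : R) : 0 <= K -> 0 <= s -> \sum_i z i = 0 ->
  (forall i j, t i - t j <= s) -> (forall i, z i <= 0 -> t i <= 0) ->
  (forall i, z i <= K * Num.max (t i) 0) ->
  forall i, `|z i| <= N%:R * (K * s).
Proof.
move=> K0 s0 z0 ts zt zK i.
have Ks0 : 0 <= K * s by exact: mulr_ge0.
have [j zj] : exists j, z j <= 0.
  apply: contrapT => nex; have zpos j : 0 < z j.
    by rewrite ltNge; apply/negP => zj; apply: nex; exists j.
  move: z0; rewrite (bigD1 i) //= => z0.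
  have : 0 <= \sum_(k < N | k != i) z k by apply: sumr_ge0 => k _; exact: ltW.
  by have := zpos i; lra.
have zKs k : z k <= K * s.
  apply: le_trans (zK k) _; rewrite ler_wpM2l // ge_max s0 andbT.
  by have := ts k j; have := zt _ zj; lra.
have N1 : 1 <= N%:R :> R by rewrite ler1n (leq_ltn_trans _ (ltn_ord i)).
rewrite ler_norml; apply/andP; split; last first.
  by apply: (le_trans (zKs i)); rewrite ler_peMl.
move: z0; rewrite (bigD1 i) //= => /eqP; rewrite addr_eq0 => /eqP ->.
rewrite lerN2; apply: le_trans (_ : \sum_(k < N | k != i) K * s <= _).
  exact: ler_sum.
apply: le_trans (_ : \sum_(k < N) K * s <= _); last first.
  by rewrite sumr_const card_ord mulr_natl.
by rewrite [leRHS](bigD1 i) //= lerDr.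
Qed.

Hypothesis E_conn : forall i j : 'I_N, connect E i j.

(** An edge contributes at most the square root of the energy, and a path has at most [N] edges. *)
Lemma spread_le t i j : t i - t j <= N%:R * Num.sqrt (edge_energy t).
Proof.
set e := Num.sqrt _; have e0 : 0 <= e by exact: sqrtr_ge0.
have edge k l : E k l -> t k - t l <= e.
  move=> Ekl; apply: le_trans (ler_norm _) _; rewrite -sqrtr_sqr.
  apply: ler_wsqrtr; rewrite /edge_energy (bigD1 l) //= (bigD1 k) //= -addrA.
  by rewrite lerDl addr_ge0 // !sumr_ge0 // => ? _; rewrite ?sumr_ge0 // => *;
     rewrite sqr_ge0.
have [p pp [-> sp]] := connect_uniq_path (E_conn i j).
rewrite card_ord in sp; apply: le_trans (_ : (size p)%:R * e <= _); last first.
  by rewrite ler_wpM2r // ler_nat.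
elim: p i {sp} pp => [|k p IHp] i /=; first by rewrite subrr mul0r.
move=> /andP[/edge Eik /IHp]; rewrite -natr1 mulrDl mul1r.
by lra.
Qed.

(* Only one of the two sides needs a margin: the other one is controlled by the
   zero sum of the deviations. *)
Lemma sqdev_le_energy (m B : R) : qmin <= m <= qmax -> 0 <= B ->
  exists2 C : R, 0 < C & forall y, \sum_i (y i - m) = 0 ->
    (forall i, `|y i - m| <= B) -> sqdev m y <= C * edge_energy (cl y).
Proof.
move=> /andP[qm mq] B0.
(* [m] may be an endpoint of the interval, but the other endpoint is then at positive distance. *)
have gap : 0 < Num.max (qmax - m) (m - qmin).
  by rewrite lt_max !subr_gt0; move: mq; rewrite le_eqVlt => /orP[/eqP->|->//];
     rewrite hq orbT.
pose g := Num.max (qmax - m) (m - qmin).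
(* On the side with margin [g], a clamped deviation equals [g] while the true one is at most
   [B <= K * g]; [1 <= K] covers the unclamped values. *)
pose K := 1 + B / g; have K1 : 1 <= K by rewrite lerDl divr_ge0 // ltW.
have K0 : 0 <= K by lra.
pose S := N%:R * (K * N%:R); exists (N%:R * S ^+ 2 + 1).
  by rewrite ltr_wpDl // mulr_ge0 ?sqr_ge0.
move=> y y0 yB; pose e := edge_energy (cl y).
have e0 : 0 <= e by do 2!apply: sumr_ge0 => ? _; rewrite sqr_ge0.
have Kg : B <= K * g.
  by rewrite /K mulrDl divfK ?gt_eqF // lerDr mul1r ltW.
have sp := spread_le (cl y); rewrite -/e in sp.
have s0 : 0 <= N%:R * Num.sqrt e by rewrite mulr_ge0 ?sqrtr_ge0.
have bound i : `|y i - m| <= S * Num.sqrt e.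
  rewrite /S -2!mulrA.
  have [gE|gE] : g = qmax - m \/ g = m - qmin.
    by rewrite /g; case: (leP (qmax - m)); [right|left].
  - apply: (@one_sided_bound (fun j => y j - m)
      (fun j => clampq qmin qmax (y j) - m)) => //.
    + by move=> k l; have := sp k l; lra.
    + by move=> k yk; have := @clampq_le (y k) m qm; lra.
    move=> k; have := yB k; rewrite ler_norml => /andP[_ yk].
    set u := Num.max _ 0; have u0 : 0 <= u by rewrite le_max lexx orbT.
    have : clampq qmin qmax (y k) - m <= u by rewrite le_max lexx.
    rewrite /clampq minElt maxElt; rewrite gE in Kg.
    by case: ifP => [?|/negbT]; case: ifP => [?|/negbT]; rewrite -?leNgt; nra.
  rewrite -normrN; apply: (@one_sided_bound (fun j => - (y j - m))
    (fun j => m - clampq qmin qmax (y j))) => //.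
  + by rewrite sumrN y0 oppr0.
  + by move=> k l; have := sp l k; lra.
  + by move=> k yk; have := @clampq_ge (y k) m mq; lra.
  move=> k; have := yB k; rewrite ler_norml => /andP[yk _].
  set u := Num.max _ 0; have u0 : 0 <= u by rewrite le_max lexx orbT.
  have : m - clampq qmin qmax (y k) <= u by rewrite le_max lexx.
  rewrite /clampq minElt maxElt; rewrite gE in Kg.
  by case: ifP => [?|/negbT]; case: ifP => [?|/negbT]; rewrite -?leNgt; nra.
rewrite mulrDl mul1r -[leLHS]addr0 lerD // -mulrA.
apply: le_trans (_ : \sum_(i < N) S ^+ 2 * e <= _); last first.
  by rewrite sumr_const card_ord mulr_natl.
apply: ler_sum => i _; rewrite -(real_normK (num_real _)) -[e]sqr_sqrtr // -exprMn.
by rewrite ler_sqr ?nnegrE // (le_trans _ (bound i)).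
Qed.

End Drift.

(** * Bit histories *)

Section BitTree.
Variables (R : realType) (I : finType).
Local Notation bits := {ffun I -> bool}.

Definition bits_weight (q : I -> R) (b : bits) : R :=
  \prod_i (if b i then q i else 1 - q i).

Lemma sum_prod_bits (f : I -> bool -> R) :
  \sum_(b : bits) \prod_i f i (b i) = \prod_i (f i true + f i false).
Proof.
by rewrite -bigA_distr_bigA /=; apply: eq_bigr => i _; rewrite big_bool.
Qed.

Lemma sum_bits_weight q : \sum_b bits_weight q b = 1.
Proof.
rewrite (sum_prod_bits (fun i c => if c then q i else 1 - q i)) big1 // => i _.
by rewrite addrC subrK.
Qed.

Lemma bits_weight_mean q i (u v : R) :
  \sum_b bits_weight q b * (if b i then u else v) = q i * u + (1 - q i) * v.
Proof.
pose f j (c : bool) := (if c then q j else 1 - q j) *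
  (if j == i then if c then u else v else 1).
transitivity (\sum_(b : bits) \prod_j f j (b j)).
  apply: eq_bigr => b _; rewrite big_split /= -/(bits_weight q b); congr (_ * _).
  by rewrite (bigD1 i) //= eqxx big1 ?mulr1 // => j /negPf ->.
rewrite sum_prod_bits (bigD1 i) //= /f eqxx big1 ?mulr1 // => j /negPf ->.
by rewrite !mulr1 addrC subrK.
Qed.

(* A history lists the bits of the successive steps, the most recent first;
   [p h i] is the conditional probability that bit i of the next step is set. *)
Variable p : seq bits -> I -> R.

(** The tower property taken as definition: the last step is averaged out first, so a one-step
    conditional bound passes to the mean. *)
Fixpoint tree_mean k (phi : seq bits -> R) : R :=
  if k is k'.+1
  then tree_mean k' (fun h => \sum_b bits_weight (p h) b * phi (b :: h))
  else phi [::].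

(** Histories of nonzero weight. Only these matter for means, and the bound on the states is
    available only along them. *)
Fixpoint reachable (h : seq bits) : bool :=
  if h is b :: h' then reachable h' && (bits_weight (p h') b != 0) else true.

Hypothesis p01 : forall h i, 0 <= p h i <= 1.

Lemma bits_weight_ge0 h b : 0 <= bits_weight (p h) b.
Proof.
by apply: prodr_ge0 => i _; have /andP[? ?] := p01 h i; case: ifP; rewrite ?subr_ge0.
Qed.

Lemma tree_mean_le k (phi psi : seq bits -> R) :
  (forall h, size h = k -> reachable h -> phi h <= psi h) ->
  tree_mean k phi <= tree_mean k psi.
Proof.
elim: k phi psi => [|k IHk] phi psi le_phi /=; first exact: le_phi.
apply: IHk => h hk rh; apply: ler_sum => b _.
have [->|wb] := eqVneq (bits_weight (p h) b) 0; first by rewrite !mul0r.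
by rewrite ler_wpM2l ?bits_weight_ge0 // le_phi //= ?hk ?rh.
Qed.

Lemma tree_mean_affine k (phi : seq bits -> R) c d :
  tree_mean k (fun h => c * phi h + d) = c * tree_mean k phi + d.
Proof.
elim: k phi => [//|k IHk] phi /=; rewrite -IHk; congr (tree_mean k _).
apply/funext => h; rewrite mulr_sumr -[d in RHS]mul1r -(sum_bits_weight (p h)).
by rewrite mulr_suml -big_split; apply: eq_bigr => b _ /=; ring.
Qed.

Lemma tree_mean_ge0 k (phi : seq bits -> R) : (forall h, 0 <= phi h) ->
  0 <= tree_mean k phi.
Proof.
move=> phi0; have := @tree_mean_le k (fun h => 0 * phi h + 0) phi.
by rewrite tree_mean_affine mul0r addr0; apply=> h _ _; rewrite mul0r addr0.
Qed.

(** * Ville's maximal inequality on the tree *)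

Section MaximalInequality.
Variables (V : seq bits -> R) (n : nat) (lam : R) (e : nat -> R).
Hypothesis V_ge0 : forall h, 0 <= V h.
Hypothesis e_ge0 : forall k, 0 <= e k.
Hypothesis V_step : forall h, reachable h ->
  \sum_b bits_weight (p h) b * V (b :: h) <= V h + e (size h).

(** The crossing of level [lam] from time [n] on, latched: it persists in every extension of the
    history. *)
Fixpoint hit (h : seq bits) : bool :=
  ((n <= size h)%N && (lam <= V h)) || (if h is _ :: h' then hit h' else false).

Lemma hitN h : (size h < n)%N -> hit h = false.
Proof.
elim: h => [|b h IHh] /= hn; rewrite ?(leqNgt n) ?hn //=.
by apply: IHh; exact: ltnW.
Qed.

(* Ville's inequality, through the process stopped at the value lam on the first
   hit. *)
Lemma tree_maximal_inequality k : 0 <= lam -> (n <= k)%N ->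
  lam * tree_mean k (fun h => (hit h)%:R) <=
  tree_mean n V + \sum_(n <= j < k) e j.
Proof.
move=> lam0 le_nk; pose S h := if hit h then lam else V h.
apply: le_trans (_ : tree_mean k S <= _).
  rewrite -[leLHS]addr0 -tree_mean_affine; apply: tree_mean_le => h _ _.
  by rewrite /S; case: (hit h); rewrite addr0 ?mulr1 ?mulr0.
rewrite -(subnKC le_nk); elim: (k - n)%N => [|j IHj].
  (* At time [n] a hit means [lam <= V h], so the stopped process starts below [V]. *)
  rewrite addn0 big_geq // addr0; apply: tree_mean_le => -[|b h] hn _; rewrite /S /=.
    by rewrite orbF; case: ifP => // /andP[].
  by rewrite hitN -?hn //= orbF; case: ifP => // /andP[].
rewrite addnS big_nat_recr ?leq_addr //= addrA; apply: le_trans (lerD IHj (lexx _)).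
rewrite -[X in _ <= X + _]mul1r -tree_mean_affine; apply: tree_mean_le => h hj rh.
(* After the hit the stopped process is constant; before it, its next value lies below that of [V],
   and [V_step] applies. *)
rewrite mul1r {2}/S; case: ifP => hh.
  rewrite (eq_bigr (fun b => bits_weight (p h) b * lam)) => [|b _].
    by rewrite -mulr_suml sum_bits_weight mul1r lerDl.
  by rewrite /S /= hh orbT.
rewrite -hj; apply: le_trans (V_step rh); apply: ler_sum => b _.
rewrite ler_wpM2l ?bits_weight_ge0 // /S /= hh orbF.
by case: ifP => // /andP[].
Qed.

End MaximalInequality.

(** * Law of the bit histories driven by independent uniforms *)

Section Realization.
Variables (d : measure_display) (T : measurableType d) (P : probability T R).
Variable U : I -> nat -> T -> R.
Hypothesis hU_unif : forall i k, uniform01 P (U i k).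
Hypothesis hU_ind : mutually_independent P (fun ik : I * nat => U ik.1 ik.2).

Fixpoint history k (w : T) : seq bits :=
  if k is k'.+1 then
    let h := history k' w in [ffun i => U i k' w < p h i] :: h
  else [::].

Lemma size_history k w : size (history k w) = k.
Proof. by elim: k => //= k ->. Qed.

Definition history_event (h : seq bits) : set T :=
  [set w | history (size h) w = h].

Definition bit_set (h : seq bits) (b : bits) (i : I) : set R :=
  [set u | (u < p h i) = b i].

(** Along a fixed [h] the thresholds are constants, so each uniform is constrained by a fixed set;
    the default [setT] covers the steps beyond [h]. *)
Fixpoint history_sets (h : seq bits) (ij : I * nat) : set R :=
  if h is b :: h' then
    if ij.2 == size h' then bit_set h' b ij.1 else history_sets h' ij
  else setT.

Fixpoint past k : seq (I * nat) :=
  if k is k'.+1 then [seq (i, k') | i <- enum I] ++ past k' else [::].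

Lemma mem_past k i j : ((i, j) \in past k) = (j < k)%N.
Proof.
elim: k => //= k IHk; rewrite mem_cat IHk [RHS]ltnS [RHS]leq_eqVlt; congr (_ || _).
apply/mapP/eqP => [[i' _ [_ ->]] //|->]; exists i => //; exact: mem_enum.
Qed.

Lemma uniq_past k : uniq (past k).
Proof.
elim: k => //= k IHk; rewrite cat_uniq IHk map_inj_uniq ?enum_uniq => [|? ? []//].
rewrite andbT /=; apply/hasPn => -[i j]; rewrite mem_past => jk.
by apply/mapP => -[i' _ [_ jE]]; rewrite jE ltnn in jk.
Qed.

Lemma measurable_bit_set h b i : measurable (bit_set h b i).
Proof.
rewrite /bit_set; case: (b i).
  by rewrite (_ : [set _ | _] = [set` `]-oo, p h i[%R]) //; apply/seteqP; split => u;
     rewrite /= in_itv.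
rewrite (_ : [set _ | _] = [set` `[p h i, +oo[%R]) //; apply/seteqP; split => u;
     rewrite /= in_itv /= andbT leNgt; first by move=> ->.
by move/negbTE.
Qed.

Lemma measurable_history_sets h ij : measurable (history_sets h ij).
Proof.
by elim: h => //= b h IHh; case: ifP => // _; exact: measurable_bit_set.
Qed.

Lemma prob_bit h b i k :
  P (U i k @^-1` bit_set h b i) = (if b i then p h i else 1 - p h i)%:E.
Proof.
have [mU PU] := hU_unif i k; have := PU _ (p01 h i).
rewrite /bit_set; case: (b i) => PUi; first by rewrite -PUi.
rewrite EFinB -PUi -probability_setC; last first.
  rewrite -[X in measurable X]setTI; have := mU measurableT _ (measurable_itv `]-oo, p h i[%R).
  by congr (measurable (_ `&` _)); apply/seteqP; split => w; rewrite /= in_itv.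
by congr (P _); apply/seteqP; split=> w /=; case: (_ < _).
Qed.

(** The bits depend on one another through the thresholds, but once these are frozen the event
    separates into one condition per uniform, to which mutual independence applies. *)
Lemma history_eventE h : history_event h =
  \bigcap_(ij in [set ij | ij \in past (size h)])
    (U ij.1 ij.2 @^-1` history_sets h ij).
Proof.
elim: h => [|b h IHh].
  by apply/seteqP; split=> w //= _ ij; rewrite /= in_nil.
apply/seteqP; split => w.
  move=> [bE hE] [i j] /=; rewrite mem_cat mem_past => ij.
  case: eqP => [->|/eqP jh]; first by rewrite -bE /bit_set /= ffunE hE.
  have : history_event h w by [].
  rewrite IHh; apply; rewrite /= mem_past; case/orP: ij => // /mapP[i' _ [_ jE]].
  by rewrite jE eqxx in jh.
move=> H; have hE : history_event h w.
  rewrite IHh => -[i j] /= ij; have := H (i, j).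
  rewrite /= mem_cat ij orbT => /(_ isT); case: eqP => // jh.
  by move: ij; rewrite mem_past jh ltnn.
rewrite /history_event /= hE; congr (_ :: _); apply/ffunP => i; rewrite ffunE.
have := H (i, size h); rewrite /= mem_cat eqxx; apply.
by rewrite map_f ?mem_enum.
Qed.

Lemma measurable_history_event h : measurable (history_event h).
Proof.
rewrite history_eventE; apply: fin_bigcap_measurable => [|[i j] _].
  exact: finite_seq.
rewrite -[X in measurable X]setTI; have [mU _] := hU_unif i j.
by apply: mU => //; exact: measurable_history_sets.
Qed.

Fixpoint history_prob (h : seq bits) : R :=
  if h is b :: h' then history_prob h' * bits_weight (p h') b else 1.

Lemma prob_history_event h : P (history_event h) = (history_prob h)%:E.
Proof.
rewrite history_eventE hU_ind ?uniq_past //; last first.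
  by move=> ij _; exact: measurable_history_sets.
elim: h => [|b h IHh] /=; first by rewrite big_nil.
rewrite big_cat big_map /= EFinM muleC; congr (_ * _)%E.
  rewrite -IHh !big_seq; apply: eq_bigr => -[i j]; rewrite mem_past /= => jh.
  by rewrite ltn_eqF.
rewrite big_enum /= /bits_weight -prodEFin; apply: eq_bigr => i _.
by rewrite eqxx prob_bit.
Qed.

Fixpoint histories k : seq (seq bits) :=
  if k is k'.+1 then [seq b :: h | h <- histories k', b <- enum {: bits}]
  else [:: [::]].

(** Exhibits a function of the history as a simple function, ready for integration. *)
Lemma sum_history (phi : seq bits -> R) k w : phi (history k w) =
  \sum_(h <- histories k) phi h * (history k w == h)%:R.
Proof.
elim: k phi => [|k IHk] phi /=; first by rewrite big_seq1 eqxx mulr1.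
rewrite big_allpairs_dep /=; set b0 := [ffun _ => _].
rewrite (IHk (fun h => phi (b0 :: h))); apply: eq_bigr => h _.
rewrite big_enum /= (bigD1 b0) //= eqseq_cons eqxx /= big1 ?addr0 // => b bb0.
by rewrite eqseq_cons eq_sym (negPf bb0) mulr0.
Qed.

Lemma tree_mean_sum k (phi : seq bits -> R) :
  tree_mean k phi = \sum_(h <- histories k) phi h * history_prob h.
Proof.
elim: k phi => [|k IHk] phi /=; first by rewrite big_seq1 mulr1.
rewrite IHk big_allpairs_dep /=; apply: eq_bigr => h _.
rewrite big_enum /= mulr_suml; apply: eq_bigr => b _; ring.
Qed.

Lemma size_histories k h : h \in histories k -> size h = k.
Proof.
elim: k h => [|k IHk] h /=; first by rewrite inE => /eqP ->.
by move=> /allpairsP[[h' b] /= [/IHk <- _ ->]].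
Qed.

(** Only finitely many histories have length [k], so [A] can be arbitrary. *)
Lemma measurable_history_preimage k (A : set (seq bits)) :
  measurable [set w | A (history k w)].
Proof.
rewrite (_ : [set _ | _] =
    \bigcup_(h in [set h | h \in histories k /\ A h]) history_event h).
  apply: fin_bigcup_measurable => [|h _]; last exact: measurable_history_event.
  by apply: sub_finite_set (finite_seq (histories k)) => h [].
have mem_h w : history k w \in histories k.
  elim: k => //= k IHk; apply/allpairsP.
  exists (history k w, [ffun i => U i k w < p (history k w) i]).
  by split=> //=; exact: mem_enum.
apply/seteqP; split => w /=.
  by move=> Aw; exists (history k w); rewrite /history_event /= ?size_history.
by move=> [h [hk Ah]]; rewrite /history_event /= (size_histories hk) => ->.
Qed.

Lemma expectation_history k (phi : seq bits -> R) : (forall h, 0 <= phi h) ->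
  ('E_P[fun w => phi (history k w)] = (tree_mean k phi)%:E)%E.
Proof.
move=> phi0; rewrite unlock.
pose A h : set T := [set w | history k w = h].
have mA h : measurable (A h) by exact: (measurable_history_preimage k [set h]).
under eq_integral => w _.
  rewrite sum_history -sumEFin; under eq_bigr => h _.
    rewrite (_ : _%:R = \1_(A h) w); last first.
      by rewrite indicE; congr (_%:R); congr nat_of_bool; apply/eqP/idP; rewrite inE.
    over.
  over.
rewrite ge0_integral_sum //; last 2 first.
- by move=> h; apply/measurable_EFinP; apply: measurable_funM => //.
- by move=> h w _; rewrite lee_fin mulr_ge0.
rewrite tree_mean_sum -sumEFin !big_seq; apply: eq_bigr => h /size_histories hk.
under eq_integral do rewrite EFinM.
rewrite ge0_integralZl_EFin //; last exact/measurable_EFinP.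
by rewrite integral_indic // setIT EFinM -prob_history_event /history_event hk.
Qed.

End Realization.
End BitTree.

(** * Convergence of perturbed descents *)

Section RealSequences.
Variable R : realType.
Implicit Types (u v e alpha : nat -> R).

(** For nonnegative terms this is summability, stated without extended reals. *)
Definition bounded_sums u : Prop := exists S : R, forall n, \sum_(0 <= k < n) u k <= S.

Lemma bounded_sums_tail e (eps : R) : (forall k, 0 <= e k) -> bounded_sums e -> 0 < eps ->
  exists K, forall m n, (K <= m)%N -> \sum_(m <= k < n) e k <= eps.
Proof.
move=> e0 [S eS] eps0; pose A := [set \sum_(0 <= k < n) e k | n in setT].
have hsA : has_sup A.
  by split; [exists (\sum_(0 <= k < 0) e k), 0%N | exists S => _ [n _ <-]].
have [_ [K _ <-] sup_lt] := sup_adherent eps0 hsA; exists K => m n Km.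
have [nm|/ltnW mn] := leqP n m; first by rewrite big_geq // ltW.
have le_sup : \sum_(0 <= k < n) e k <= sup A.
  by apply: ub_le_sup; [exact: hsA.2 | exists n].
rewrite (@big_cat_nat _ _ _ m) //= (@big_cat_nat _ _ _ K) //= in le_sup.
have : 0 <= \sum_(K <= k < m) e k by apply: sumr_ge0.
by lra.
Qed.

Lemma bounded_sums_le u v : (forall k, u k <= v k) -> bounded_sums v -> bounded_sums u.
Proof. by move=> uv [S vS]; exists S => n; apply: le_trans (vS n); apply: ler_sum. Qed.

Lemma bounded_sumsD u v : bounded_sums u -> bounded_sums v ->
  bounded_sums (fun k => u k + v k).
Proof.
by move=> [S uS] [S' vS]; exists (S + S') => n; rewrite big_split lerD.
Qed.

Lemma bounded_sumsZ (c : R) u : 0 <= c -> bounded_sums u ->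
  bounded_sums (fun k => c * u k).
Proof.
by move=> c0 [S uS]; exists (c * S) => n; rewrite -mulr_sumr ler_wpM2l.
Qed.

Lemma bounded_sums_inv_sqr : bounded_sums (fun k => (k.+1%:R ^- 2 : R)).
Proof.
exists 2 => -[|n]; first by rewrite big_geq.
(* The sharper bound makes the induction telescope. *)
apply: (@le_trans _ _ (2 - n.+1%:R^-1)); last by rewrite gerBl invr_ge0.
elim: n => [|n IHn]; first by rewrite big_nat1 expr1n invr1; lra.
rewrite big_nat_recr //=; apply: le_trans (lerD IHn (lexx _)) _.
suff : n.+2%:R ^- 2 <= n.+1%:R^-1 - n.+2%:R^-1 :> R.
  by move: (_ ^- 2 : R) (n.+1%:R^-1 : R) (n.+2%:R^-1 : R) => x y z; lra.
have n0 : 0 < n.+1%:R :> R by [].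
have -> : n.+1%:R^-1 - n.+2%:R^-1 = (n.+1%:R * n.+2%:R)^-1 :> R.
  by rewrite -natr1; field; apply/andP; split; apply: lt0r_neq0; lra.
rewrite lef_pV2 ?posrE ?mulr_gt0 ?exprn_gt0 // expr2.
by rewrite ler_wpM2r // ler_nat.
Qed.

(** Once the error tail is below [eps / 2], staying above [eps / 2] would let the divergent sum of
    [alpha] drive [v] negative. So [v] gets below [eps / 2] at some time and can later rise only by
    the tail. *)
Lemma perturbed_descent_cvg0 v alpha e (c : R) : 0 < c ->
  (forall k, 0 <= v k) -> (forall k, 0 < alpha k) -> (forall k, 0 <= e k) ->
  bounded_sums e -> ~ bounded_sums alpha ->
  (forall k, v k.+1 <= v k - c * alpha k * v k + e k) ->
  v @ \oo --> 0.
Proof.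
move=> c0 v0 a0 e0 be na vS; apply/cvgr0Pnorm_le => eps eps0.
have eps20 : 0 < eps / 2 by rewrite divr_gt0.
have [K tailK] := bounded_sums_tail e0 be eps20.
have [n Kn vn] : exists2 n, (K <= n)%N & v n <= eps / 2.
  apply: contrapT => nex; apply: na.
  have v_gt k : (K <= k)%N -> eps / 2 < v k.
    by move=> Kk; rewrite ltNge; apply/negP => vk; apply: nex; exists k.
  have desc j : v (K + j)%N + c * (eps / 2) * \sum_(K <= k < K + j) alpha k <=
      v K + \sum_(K <= k < K + j) e k.
    elim: j => [|j IHj]; first by rewrite addn0 !big_geq // mulr0 !addr0.
    rewrite addnS !big_nat_recr ?leq_addr //=.
    have := vS (K + j)%N; have := v_gt _ (leq_addr j K); have := a0 (K + j)%N.
    have : 0 < c * alpha (K + j)%N by exact: mulr_gt0.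
    move: IHj; move: (v _) (v _) (alpha _) (e _) (\sum_(_ <= _ < _) _)
      (\sum_(_ <= _ < _) _) => *; nra.
  pose B := (v K + eps / 2) / (c * (eps / 2)).
  have ce0 : 0 < c * (eps / 2) by exact: mulr_gt0.
  have leB j : \sum_(K <= k < K + j) alpha k <= B.
    rewrite ler_pdivlMr // mulrC; have := desc j; have := v0 (K + j)%N.
    by have := tailK K (K + j)%N (leqnn K); lra.
  exists (\sum_(0 <= k < K) alpha k + B) => n.
  apply: le_trans (_ : \sum_(0 <= k < K + n) alpha k <= _).
    rewrite addnC (@big_cat_nat _ _ _ n 0 (n + K)) ?leq_addr //=.
    by rewrite lerDl sumr_ge0 // => k _; rewrite ltW.
  rewrite (@big_cat_nat _ _ _ K) ?leq_addr //=.
  by rewrite lerD2l.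
exists n => // m /= nm; rewrite ger0_norm //.
have stay j : v (n + j)%N <= v n + \sum_(n <= k < n + j) e k.
  elim: j => [|j IHj]; first by rewrite addn0 big_geq // addr0.
  rewrite addnS big_nat_recr ?leq_addr //=; have := vS (n + j)%N.
  have : 0 <= c * alpha (n + j)%N * v (n + j)%N.
    by rewrite !mulr_ge0 // ltW.
  by lra.
rewrite -(subnKC nm); have := stay (m - n)%N; have := tailK n (n + (m - n))%N Kn.
by lra.
Qed.

End RealSequences.

(** * Convergence in mean and almost surely along random histories *)

Section TreeConvergence.
Variables (R : realType) (I : finType).
Local Notation bits := {ffun I -> bool}.
Variables (p : seq bits -> I -> R) (V : seq bits -> R).
Variables (alpha e : nat -> R) (c : R).
Hypothesis p01 : forall h i, 0 <= p h i <= 1.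
Hypothesis V_ge0 : forall h, 0 <= V h.
Hypothesis c_gt0 : 0 < c.
Hypothesis alpha_gt0 : forall k, 0 < alpha k.
Hypothesis alpha_div : ~ bounded_sums alpha.
Hypothesis e_ge0 : forall k, 0 <= e k.
Hypothesis e_sum : bounded_sums e.
Hypothesis V_descent : forall h, reachable p h ->
  \sum_b bits_weight (p h) b * V (b :: h) <=
  V h - c * alpha (size h) * V h + e (size h).

Lemma tree_mean_cvg0 : tree_mean p k V @[k --> \oo] --> 0.
Proof.
apply: (@perturbed_descent_cvg0 _ _ alpha e c) => // [k|k].
  exact: tree_mean_ge0.
rewrite (_ : _ - _ + _ = (1 - c * alpha k) * tree_mean p k V + e k); last by ring.
rewrite -tree_mean_affine /=; apply: tree_mean_le => // h <- rh.
by have := V_descent rh; lra.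
Qed.

Variables (d : measure_display) (T : measurableType d) (P : probability T R).
Variable U : I -> nat -> T -> R.
Hypothesis hU_unif : forall i k, uniform01 P (U i k).
Hypothesis hU_ind : mutually_independent P (fun ik : I * nat => U ik.1 ik.2).
Local Notation hist := (history p U).

Lemma hit_history n lam j k w : (n <= j <= k)%N -> lam <= V (hist j w) ->
  hit V n lam (hist k w).
Proof.
have self h : (n <= size h)%N -> lam <= V h -> hit V n lam h.
  by case: h => [|b h] /= -> ->.
move=> /andP[nj jk] lamV; move: jk; elim: k => [|k IHk].
  by rewrite leqn0 => /eqP j0; move: nj lamV; rewrite j0; exact: (self (hist 0 w)).
rewrite leq_eqVlt => /orP[/eqP jE|/IHk hk]; last by rewrite /= hk orbT.
by move: nj lamV; rewrite jE => nk; apply: self; rewrite (size_history p U k.+1 w).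
Qed.

Lemma hitS n lam k w : hit V n lam (hist k w) -> hit V n lam (hist k.+1 w).
Proof. by move=> hk; rewrite /= hk orbT. Qed.

Let hit_event n lam : set T := \bigcup_k [set w | hit V n lam (hist k w)].

Let measurable_hit n lam k : measurable [set w | hit V n lam (hist k w)].
Proof. exact: (measurable_history_preimage p hU_unif k [set h | hit V n lam h]). Qed.

(** The events of a hit by time [k] increase with [k], so the maximal inequality passes to their
    union by continuity from below. *)
Lemma prob_hit_event n lam (eps : R) : 0 < lam ->
  (forall k, (n <= k)%N -> tree_mean p n V + \sum_(n <= j < k) e j <= eps) ->
  (P (hit_event n lam) <= (eps / lam)%:E)%E.
Proof.
move=> lam0 le_eps; pose F k := [set w | hit V n lam (hist k w)].
have F_nd : nondecreasing_seq F.
  apply/nondecreasing_seqP => k; apply/subsetPset => w; exact: hitS.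
have mF : measurable (\bigcup_k F k).
  by apply: bigcup_measurable => k _; exact: measurable_hit.
have cvgF := nondecreasing_cvg_mu (mu := P) (measurable_hit n lam) mF F_nd.
rewrite /hit_event -(cvg_lim _ cvgF) //; apply: lime_le.
  by apply/cvg_ex; eexists; exact: cvgF.
exists n => // k /= nk; rewrite -expectation_indic //.
rewrite (_ : \1_(F k) = fun w => (hit V n lam (hist k w))%:R :> R); last first.
  by apply/funext => w; rewrite indicE mem_setE.
rewrite (expectation_history p01 hU_unif hU_ind k
  (phi := fun h => (hit V n lam h)%:R)) // lee_fin ler_pdivlMr // mulrC.
apply: le_trans (le_eps k nk).
apply: tree_maximal_inequality => // [h rh|]; last exact: ltW.
(* Dropping the descent term leaves an almost-supermartingale inequality. *)
apply: le_trans (V_descent rh) _; rewrite lerD2r gerBl !mulr_ge0 //; exact: ltW.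
Qed.

(** Divergence puts [w] in some [bad m], where the level [lam m] is reached after every time [n];
    the probability of this is small for large [n], as the mean at [n] and the error tail both
    are. *)
Lemma history_cvg0_ae : {ae P, forall w, V (hist k w) @[k --> \oo] --> 0}.
Proof.
pose lam m : R := m.+1%:R^-1.
have lam0 m : 0 < lam m by rewrite invr_gt0.
pose bad m := \bigcap_n hit_event n (lam m).
have mev n m : measurable (hit_event n (lam m)).
  by apply: bigcup_measurable => k _; exact: measurable_hit.
have mbad m : measurable (bad m).
  exact: bigcapT_measurable.
apply: (@negligibleS _ _ _ _ (\bigcup_m bad m)).
  move=> w /= ncv; apply: contrapT => nbad; apply: ncv.
  apply/cvgr0Pnorm_lt => eps eps0.
  have [m lam_eps] : exists m, lam m < eps.
    have [m _ le_m] := near_infty_natSinv_lt (PosNum eps0).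
    by exists m; apply: (le_m m) => /=.
  have [n nhit] : exists n, ~ hit_event n (lam m) w.
    apply: contrapT => nex; apply: nbad; exists m => // n _.
    by apply: contrapT => hn; apply: nex; exists n.
  exists n => // k /= nk; rewrite ger0_norm // ltNge; apply/negP => le_V.
  apply: nhit; exists k => //=; apply: (@hit_history _ _ k); rewrite ?nk ?leqnn //.
  exact: le_trans (ltW lam_eps) le_V.
apply: negligible_bigcup => m; apply/negligibleP => //.
apply/eqP; rewrite -measure_le0; apply/lee_addgt0Pr => eps eps0; rewrite add0e.
(* Half for the mean and half for the error tail; division by the level leaves [eps]. *)
have eps20 : 0 < eps * lam m / 2 by rewrite !mulr_gt0.
have [K tailK] := bounded_sums_tail e_ge0 e_sum eps20.
have /cvgr0Pnorm_le/(_ _ eps20)[K' _ le_mean] := tree_mean_cvg0.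
pose n := maxn K K'.
apply: le_trans (_ : P (hit_event n (lam m)) <= _)%E.
  by apply: le_measure; rewrite ?inE // => w; apply.
apply: le_trans (prob_hit_event (eps := eps * lam m) _ _) _ => // [k nk|].
  have := tailK n k (leq_maxl _ _); have /= := le_mean n (leq_maxr _ _).
  by rewrite ger0_norm ?tree_mean_ge0 //; lra.
by rewrite lee_fin mulfK ?gt_eqF.
Qed.

End TreeConvergence.

(** * The consensus process *)

Section QuantizedConsensus.
Variables (R : realType) (N : nat) (E : rel 'I_N).
Variables (qmin qmax : R) (y0 : 'I_N -> R) (gamma alpha : nat -> R).
Hypothesis E_conn : forall i j : 'I_N, connect E i j.
Hypothesis E_out : forall i : 'I_N, exists j, E i j.
Hypothesis hq : qmin < qmax.
Hypothesis hy0 : qmin <= avg y0 <= qmax.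
Hypothesis gamma_stage : forall n k : nat, (2 ^ n - 1 <= k <= 2 ^ n.+1 - 2)%N ->
  gamma k = (2 ^+ n)^-1.
Hypothesis alpha_gt0 : forall k, 0 < alpha k.
Hypothesis alpha_dec : forall k, alpha k.+1 <= alpha k.
Hypothesis alpha_sqr : bounded_sums (fun k => alpha k ^+ 2).

Local Notation bits := {ffun 'I_N -> bool}.
Local Notation a k := (weights E gamma k).
Local Notation m := (avg y0).

Definition levels (b : bits) i : R := if b i then qmax else qmin.

Fixpoint state (h : seq bits) : 'I_N -> R :=
  if h is b :: h' then
    fun i => state h' i + alpha (size h') * flow E (a (size h')) (levels b) i
  else y0.

Definition bit_prob (h : seq bits) i : R := probq qmin qmax (state h i).

Lemma bit_prob01 h i : 0 <= bit_prob h i <= 1.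
Proof.
have /andP[? ?] := clampq_bounds hq (state h i).
rewrite /bit_prob /probq ler_pdivlMr ?ler_pdivrMr ?subr_gt0 //.
by rewrite mul0r mul1r subr_ge0 lerD2r; apply/andP; split.
Qed.

(** A broadcast depends on its uniform only through the comparison with [probq], which is the
    recorded bit. *)
Lemma traj_state (d : measure_display) (T : measurableType d)
    (U : 'I_N -> nat -> T -> R) k w :
  traj E gamma alpha qmin qmax y0 (fun i k => U i k w) k =
  state (history bit_prob U k w).
Proof.
elim: k => //= k ->; set h := history _ _ _ _.
apply/funext => i; rewrite size_history /flow [in RHS]mulrDr [in RHS]addrA [in X in _ = _ + X]mulrA.
congr (_ + _ * _ + _ * _).
- by apply: eq_bigr => j _; rewrite /levels !ffunE.
- by rewrite /levels ffunE.
Qed.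

Lemma gamma_gt0 k : 0 < gamma k.
Proof. by have [n /gamma_stage ->] := stageP k; rewrite invr_gt0 exprn_gt0. Qed.

Lemma sum_state h : \sum_i (state h i - m) = 0.
Proof.
have [N0|N0] := posnP N.
  by rewrite big1 // => i _; have := ltn_ord i; rewrite {2}N0.
rewrite sumrB sumr_const card_ord /avg -[_ *+ N]mulr_natr divfK ?pnatr_eq0 -?lt0n //.
elim: h => [|b h IHh] /=; first by rewrite subrr.
by rewrite big_split /= -mulr_sumr flow_sum0 mulr0 addr0.
Qed.

Lemma levels_mean h i :
  \sum_b bits_weight (bit_prob h) b * levels b i = clampq qmin qmax (state h i).
Proof.
rewrite (bits_weight_mean (bit_prob h) i qmax qmin) /bit_prob /probq.
by field; rewrite subr_eq0 gt_eqF.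
Qed.

Let Q : R := `|qmin| + `|qmax|.

Let Q0 : 0 <= Q. Proof. by rewrite addr_ge0. Qed.

Lemma norm_levels_le b i : `|levels b i| <= Q.
Proof. by rewrite /levels /Q; case: (b i); rewrite ?lerDl ?lerDr. Qed.

(** For a saturated node the probability of broadcasting [qmax] is 0 or 1, so the wrong bit has
    weight zero. *)
Lemma bits_weight_neq0 h b i : bits_weight (bit_prob h) b != 0 ->
  (qmax <= state h i -> b i) /\ (state h i <= qmin -> ~~ b i).
Proof.
rewrite /bits_weight prodf_seq_neq0 => /allP/(_ i (mem_index_enum _)) /=.
rewrite /bit_prob /probq /clampq; case: (b i) => pn0; split=> // le_q.
- apply: contra_neqN pn0 => _; rewrite max_r // min_l ?subrr ?mul0r //; exact: ltW.
- apply: contra_neqT pn0 => _.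
  by rewrite min_r ?divff ?subrr ?subr_eq0 ?gt_eqF // le_max le_q.
Qed.

(** The deficit is of order [gamma k <= 2 / k.+1%:R], and a product is at most the sum of the
    squares of its factors. *)
Lemma alpha_deficit_sums : bounded_sums (fun k => alpha k * deficit E gamma k).
Proof.
have [C C0 leC] := deficit_gamma gamma_gt0 E_conn E_out gamma_stage.
apply: bounded_sums_le (_ : bounded_sums
    (fun k => C * (alpha k ^+ 2 + 4 * k.+1%:R ^- 2))); last first.
  apply: (bounded_sumsZ C0); apply: bounded_sumsD => //.
  by apply: bounded_sumsZ => //; exact: bounded_sums_inv_sqr.
move=> k; apply: le_trans (_ : alpha k * (C * gamma k) <= _).
  by rewrite ler_wpM2l ?leC // ltW.
rewrite mulrCA ler_wpM2l //; have := gamma_le gamma_stage k; have g0 := gamma_gt0 k.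
have a0 := alpha_gt0 k; have : 0 < k.+1%:R^-1 :> R by rewrite invr_gt0.
rewrite -exprVn; move: (k.+1%:R^-1 : R) g0 a0 => t; move: (gamma k) (alpha k).
move=> g al g0 al0 t0 gt; have : g ^+ 2 <= 4 * t ^+ 2 by nra.
by have := sqr_ge0 (al - g); have := sqr_ge0 al; nra.
Qed.

Lemma weights_bounded : exists2 A : R, 0 <= A &
  forall k i j, E j i -> 1 <= a k i j <= A.
Proof.
have [M M0 leM] := fired_bounded gamma_gt0 E_conn E_out.
exists (1 + M) => [|k i j Eji]; first by rewrite addr_ge0.
by rewrite weights_fired // lerDl lerD2l leM fired_ge0 //; exact: gamma_gt0.
Qed.

Lemma flow_bounded : exists2 F : R, 0 <= F &
  forall k b i, `|flow E (a k) (levels b) i| <= F.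
Proof.
have [A A0 leA] := weights_bounded.
exists (N%:R * (A * (Q + Q)) + deficit E gamma 0 * Q) => [|k b i].
  by rewrite addr_ge0 ?mulr_ge0 ?addr_ge0 ?deficit_ge0.
apply: norm_flow_le => // [j Eji|j|].
- have /andP[a1 aA] := leA k i j Eji; rewrite ger0_norm //.
  exact: le_trans a1.
- exact: norm_levels_le.
- exact: le_trans (norm_bal_le E gamma k i) (deficit_le E gamma_gt0 (leq0n k)).
Qed.

Lemma alpha_le0 k : alpha k <= alpha 0.
Proof. by elim: k => // k; apply: le_trans. Qed.

(* A node outside the quantization interval broadcasts the nearest endpoint and
   is pulled back, up to an error proportional to the imbalance. *)
Lemma state_bounded : exists2 B : R, 0 <= B &
  forall h, reachable bit_prob h -> forall i, `|state h i| <= B.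
Proof.
have [F F0 leF] := flow_bounded; have [A A0 leA] := weights_bounded.
have [S leS] := alpha_deficit_sums.
have aF0 : 0 <= alpha 0 * F by rewrite mulr_ge0 // ltW.
(* Besides the initial values, [M0] leaves room for one full step, of size at most [alpha 0 * F],
   out of the range [[- Q, Q]]. *)
have [M0 M0ge M0y] : exists2 M0 : R, Q + alpha 0 * F <= M0 & forall i, `|y0 i| <= M0.
  exists (Q + alpha 0 * F + \sum_i `|y0 i|) => [|i].
    by rewrite lerDl sumr_ge0.
  rewrite (bigD1 i) //= addrCA lerDl addr_ge0 //; first exact: addr_ge0.
  exact: sumr_ge0.
have M00 : 0 <= M0 by apply: le_trans M0ge; exact: addr_ge0.
have ad0 k : 0 <= alpha k * deficit E gamma k.
  by rewrite mulr_ge0 ?deficit_ge0 // ltW.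
have S0 : 0 <= S by have := leS 0%N; rewrite big_geq.
exists (M0 + Q * S) => [|h rh i]; first by rewrite !addr_ge0 // mulr_ge0.
pose s n := \sum_(0 <= k < n) alpha k * deficit E gamma k.
have s0 n : 0 <= s n by apply: sumr_ge0.
(* The induction needs a bound that grows with the imbalance errors accumulated so far. *)
suff: `|state h i| <= M0 + Q * s (size h).
  by move=> /le_trans; apply; rewrite lerD2l ler_wpM2l ?leS.
elim: h rh i => [_|b h IHh /= /andP[rh /bits_weight_neq0 wb]] i.
  by rewrite /= /s big_geq // mulr0 addr0.
have := IHh rh i; have [b1 b0] := wb i; rewrite /s big_nat_recr //= -/(s _).
set k := size h; set y := state h i.
have := leF k b i; rewrite !ler_norml => /andP[fl fu] /andP[yl yu].
have ak := alpha_gt0 k; have ak0 := alpha_le0 k.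
have afu : alpha k * flow E (a k) (levels b) i <= alpha 0 * F by nra.
have afl : - (alpha 0 * F) <= alpha k * flow E (a k) (levels b) i by nra.
have [qQ Qq] : - Q <= qmin /\ qmax <= Q.
  have := ler_norm qmax; have := ler_norm (- qmin); rewrite normrN /Q.
  by have := normr_ge0 qmin; have := normr_ge0 qmax; split; lra.
have adk := ad0 k; have lvl j : qmin <= levels b j <= qmax.
  by rewrite /levels; case: (b j); rewrite lexx ltW.
have balx : alpha k * `|bal E (a k) i * levels b i| <=
    Q * (alpha k * deficit E gamma k).
  rewrite mulrCA ler_wpM2l ?(ltW ak) // normrM mulrC.
  by rewrite ler_pM ?norm_levels_le // norm_bal_le.
have Qs0 : 0 <= Q * s k by rewrite mulr_ge0.
have err0 : 0 <= Q * (alpha k * deficit E gamma k) by rewrite mulr_ge0.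
(* Outside the interval the sign of the edge terms controls the outward side; the margin in [M0]
   handles the inward side and the case of an interior state. *)
have q_lt := hq; have [hi|lo] := leP qmax y.
  have xi : levels b i = qmax by rewrite /levels b1.
  have : flow E (a k) (levels b) i <= `|bal E (a k) i * levels b i|.
    rewrite /flow -[leRHS]add0r lerD ?ler_norm // sumr_le0 // => j Eji.
    have /andP[a1 _] := leA k i j Eji; have /andP[_ lj] := lvl j.
    by rewrite xi mulr_ge0_le0 ?subr_le0 // (le_trans ler01).
  rewrite -(ler_pM2l ak) => /le_trans/(_ balx) ?.
  by apply/andP; split; lra.
have [lo'|hi'] := leP y qmin.
  have xi : levels b i = qmin by rewrite /levels (negPf (b0 lo')).
  have : - `|bal E (a k) i * levels b i| <= flow E (a k) (levels b) i.
    rewrite /flow -[leLHS]add0r lerD //; last by rewrite lerNl -normrN ler_norm.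
    apply: sumr_ge0 => j Eji; have /andP[a1 _] := leA k i j Eji.
    by have /andP[lj _] := lvl j; rewrite xi mulr_ge0 ?subr_ge0 // (le_trans ler01).
  rewrite -(ler_pM2l ak) mulrN; rewrite -lerN2 in balx; move=> /(le_trans balx) ?.
  by apply/andP; split; lra.
by apply/andP; split; lra.
Qed.

(** Expansion of the square: the flow is linear and the quantizer is unbiased for the clamped state,
    so the cross term is a flow of clamped states. *)
Lemma sqdev_step h : \sum_b bits_weight (bit_prob h) b * sqdev m (state (b :: h)) =
  sqdev m (state h)
  + 2 * alpha (size h) * (\sum_i (state h i - m) *
      flow E (a (size h)) (fun j => clampq qmin qmax (state h j)) i)
  + alpha (size h) ^+ 2 * (\sum_b bits_weight (bit_prob h) b *
      \sum_i flow E (a (size h)) (levels b) i ^+ 2).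
Proof.
set al := alpha _; set A := a _; set z := state h.
transitivity (\sum_b bits_weight (bit_prob h) b * (sqdev m z
    + 2 * al * (\sum_i (z i - m) * flow E A (levels b) i)
    + al ^+ 2 * \sum_i flow E A (levels b) i ^+ 2)).
  apply: eq_bigr => b _; congr (_ * _).
  rewrite /sqdev !mulr_sumr -!big_split; apply: eq_bigr => i _ /=.
  by rewrite -/al -/A -/z; ring.
under eq_bigr do rewrite !mulrDr; rewrite !big_split /=.
congr (_ + _ + _).
- by rewrite -mulr_suml sum_bits_weight mul1r.
- under eq_bigr do rewrite mulrCA mulr_sumr; rewrite -mulr_sumr exchange_big /=.
  congr (_ * _); apply: eq_bigr => i _.
  under eq_bigr do rewrite mulrCA; rewrite -mulr_sumr flow_mean.
  by congr (_ * flow _ _ _ _); apply/funext => j; exact: levels_mean.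
- by under eq_bigr do rewrite mulrCA; rewrite -mulr_sumr.
Qed.

Lemma sqdev_descent : exists c : R, exists e : nat -> R,
  [/\ 0 < c, forall k, 0 <= e k, bounded_sums e &
   forall h, reachable bit_prob h ->
     \sum_b bits_weight (bit_prob h) b * sqdev m (state (b :: h)) <=
     sqdev m (state h) - c * alpha (size h) * sqdev m (state h) + e (size h)].
Proof.
have [F F0 leF] := flow_bounded; have [A A0 leA] := weights_bounded.
have [B B0 leB] := state_bounded.
pose B' := B + `|m|; have B'0 : 0 <= B' by rewrite addr_ge0.
have [C C0 leC] := sqdev_le_energy hq E_conn hy0 B'0.
pose K := 2 * N%:R * (2 * Q ^+ 2 + B' * Q).
have K0 : 0 <= K by rewrite !mulr_ge0 ?addr_ge0 ?mulr_ge0 ?sqr_ge0.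
have NF0 : 0 <= N%:R * F ^+ 2 by rewrite mulr_ge0 ?sqr_ge0.
(* The factor 2 of the cross term cancels the half in front of the energy, leaving the rate [C^-1];
   the error collects the imbalance part of the drift and the second moment of the flow. *)
exists C^-1.
exists (fun k => K * (alpha k * deficit E gamma k) + N%:R * F ^+ 2 * alpha k ^+ 2).
split => [|k||h rh]; first by rewrite invr_gt0.
- by rewrite addr_ge0 // mulr_ge0 ?sqr_ge0 // mulr_ge0 ?deficit_ge0 // ltW.
- by apply: bounded_sumsD; apply: bounded_sumsZ => //; exact: alpha_deficit_sums.
rewrite sqdev_step; set k := size h; set V := sqdev m _.
have dev i : `|state h i - m| <= B'.
  by apply: le_trans (ler_normB _ _) _; rewrite lerD2r leB.
have le_drift := @drift_le _ _ E _ _ hq (a k) (state h) m (deficit E gamma k) B' Q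
  hy0 B'0 Q0 _ _ _ (norm_bal_le E gamma k) dev.
have {le_drift} := le_drift _ _ _; rewrite /Q lerDl lerDr !normr_ge0.
move=> /(_ isT isT) le_drift.
have {}le_drift := le_drift (fun i j Eji => proj1 (andP (leA k i j Eji))).
have le_V : V <= C * _ := leC _ (sum_state h) dev.
rewrite -/Q in le_drift.
have le_sq : \sum_b bits_weight (bit_prob h) b *
    (\sum_i flow E (a k) (levels b) i ^+ 2) <= N%:R * F ^+ 2.
  apply: le_trans (_ : \sum_b bits_weight (bit_prob h) b * (N%:R * F ^+ 2) <= _).
    apply: ler_sum => b _; rewrite ler_wpM2l ?(bits_weight_ge0 bit_prob01) //.
    apply: le_trans (_ : \sum_(i < N) F ^+ 2 <= _).
      apply: ler_sum => i _; rewrite -(real_normK (num_real _)).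
      by rewrite ler_sqr ?nnegrE.
    by rewrite sumr_const card_ord mulr_natl.
  by rewrite -mulr_suml sum_bits_weight mul1r.
move: le_V; rewrite mulrC -ler_pdivrMr //.
move: le_drift le_sq; set D := edge_energy _ _; set X := \sum_i _; set Y := \sum_b _.
move=> le_drift le_sq le_V; have ak := alpha_gt0 k.
have := ler_wpM2l (ltW ak) le_drift; have := ler_wpM2l (ltW ak) le_V.
have := ler_wpM2l (sqr_ge0 (alpha k)) le_sq; rewrite /K.
by lra.
Qed.

End QuantizedConsensus.

(** * Series hypotheses, the degenerate graph and the conclusion *)

Lemma bounded_sums_nneseries (R : realType) (u : nat -> R) : (forall k, 0 <= u k) ->
  bounded_sums u <-> (\sum_(1 <= k <oo) (u k)%:E < +oo)%E.
Proof.
move=> u0; have ue0 k : (0 <= (u k)%:E)%E by rewrite lee_fin.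
split=> [[S uS]|ltoo].
  apply: (@le_lt_trans _ _ S%:E); last exact: ltry.
  apply: lime_le; first by apply: is_cvg_nneseries.
  near=> n; rewrite sumEFin lee_fin; apply: le_trans (uS n).
  rewrite [leRHS](@big_cat_nat _ _ _ 1) //=; last by near: n; exists 1%N.
  by rewrite lerDr sumr_ge0.
exists (u 0 + fine (\sum_(1 <= k <oo) (u k)%:E)%E) => n.
apply: le_trans (_ : \sum_(0 <= k < n.+1) u k <= _).
  by rewrite big_nat_recr //= lerDl.
rewrite big_ltn // lerD2l -lee_fin fineK; last first.
  by rewrite ge0_fin_numE // nneseries_ge0.
by rewrite -sumEFin; apply: nneseries_lim_ge.
Unshelve. all: by end_near. Qed.

(** With no two distinct nodes and no self-loops there are no edges: nothing moves, and the initial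
    value is its own average. *)
Lemma traj_trivial (R : realType) (N : nat) (E : rel 'I_N) (gamma alpha : nat -> R)
    (qmin qmax : R) (y0 : 'I_N -> R) u k :
  irreflexive E -> (forall i j : 'I_N, i = j) ->
  forall i, traj E gamma alpha qmin qmax y0 u k i = avg y0.
Proof.
move=> E_irr all_eq i.
have noE j l : E j l = false by rewrite (all_eq j l) E_irr.
have -> : avg y0 = y0 i.
  rewrite /avg (eq_bigr (fun=> y0 i)) => [|j _]; last by rewrite (all_eq j i).
  rewrite sumr_const card_ord -[_ *+ N]mulr_natr mulfK // pnatr_eq0 -lt0n.
  exact: leq_ltn_trans (ltn_ord i).
have no_in (f : 'I_N -> R) l : \sum_(j | E j l) f j = 0 by rewrite big_pred0.
have no_out (f : 'I_N -> R) l : \sum_(j | E l j) f j = 0 by rewrite big_pred0.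
by elim: k => //= k ->; rewrite /bal !no_in no_out subrr !mulr0 mul0r !addr0.
Qed.

Lemma no_out_neighbour (T : finType) (e : rel T) (i : T) :
  (forall j, ~~ e i j) -> (forall j, connect e i j) -> forall j, j = i.
Proof.
move=> no_out e_conn j; have /connectP[[|l p] /=] := e_conn j; first by [].
by rewrite (negPf (no_out l)).
Qed.

Theorem theorem2 (R : realType) (d : measure_display) (T : measurableType d)
  (P : probability T R) (N : nat) (E : rel 'I_N)
  (E_irr : irreflexive E) (E_sc : forall i j : 'I_N, connect E i j)
  (qmin qmax : R) (hq : qmin < qmax)
  (y0 : 'I_N -> R) (hy0 : qmin <= avg y0 <= qmax)
  (gamma alpha : nat -> R)
  (hgamma : forall n k : nat, (2 ^ n - 1 <= k <= 2 ^ n.+1 - 2)%N ->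
      gamma k = (2 ^+ n)^-1)
  (halpha_pos : forall k, 0 < alpha k)
  (halpha_dec : forall k, alpha k.+1 <= alpha k)
  (halpha_div : (\sum_(1 <= k <oo) (alpha k)%:E = +oo)%E)
  (halpha_sq : (\sum_(1 <= k <oo) ((alpha k) ^+ 2)%:E < +oo)%E)
  (U : 'I_N -> nat -> T -> R)
  (hU_unif : forall i k, uniform01 P (U i k))
  (hU_ind : mutually_independent P (fun ik : 'I_N * nat => U ik.1 ik.2)) :
  let y := fun (k : nat) (w : T) =>
    traj E gamma alpha qmin qmax y0 (fun i k => U i k w) k in
  {ae P, forall w, forall i, ((y k w i) @[k --> \oo] --> avg y0)%R} /\
  ('E_P[fun w => (\sum_i (y k w i - avg y0) ^+ 2)%R])%E @[k --> \oo] --> 0%E.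
Proof.
move=> y.
(* By strong connectivity a node without out-neighbours is the only node, a case treated apart. *)
have [E_out|] := pselect (forall i, exists j, E i j); last first.
  move=> /existsNP[i /forallNP no_out].
  have y_cst k w l : y k w l = avg y0.
    apply: traj_trivial => // j j'.
    have eq_i := @no_out_neighbour _ E i (fun j => introN idP (no_out j)) (E_sc i).
    by rewrite (eq_i j) (eq_i j').
  split.
    by apply: aeW => w l; under eq_fun do rewrite y_cst; exact: cvg_cst.
  rewrite (_ : (fun k => _) = cst 0%E); first exact: cvg_cst.
  apply/funext => k /=; rewrite (_ : (fun w => _) = cst 0) ?expectation_cst //.
  by apply/funext => w; rewrite big1 // => l _; rewrite y_cst subrr expr0n.
have alpha_sqr : bounded_sums (fun k => alpha k ^+ 2).
  by apply/bounded_sums_nneseries => // k; rewrite sqr_ge0.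
have alpha_div : ~ bounded_sums alpha.
  move=> /(bounded_sums_nneseries (fun k => ltW (halpha_pos k))).
  by rewrite halpha_div ltxx.
pose p := bit_prob E qmin qmax y0 gamma alpha.
pose V h := sqdev (avg y0) (state E qmin qmax y0 gamma alpha h).
have p01 h i : 0 <= p h i <= 1 by exact: bit_prob01.
have V0 h : 0 <= V h by apply: sumr_ge0 => i _; exact: sqr_ge0.
have [c [e [c0 e0 e_sum descent]]] := sqdev_descent E_sc E_out hq hy0 hgamma
  halpha_pos halpha_dec alpha_sqr.
have yE k w : y k w = state E qmin qmax y0 gamma alpha (history p U k w).
  exact: traj_state.
split.
  have := history_cvg0_ae p01 V0 c0 halpha_pos alpha_div e0 e_sum descent
    hU_unif hU_ind.
  apply: filterS => w V_cvg i; apply/cvgrPdist_le => eps eps0.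
  (* The squared deviation of one coordinate is a term of [V], whence the tolerance [eps ^+ 2]. *)
  move/cvgr0Pnorm_le : V_cvg => /(_ (eps ^+ 2) (exprn_gt0 2 eps0)).
  apply: filterS => k; rewrite ger0_norm // yE => le_V.
  rewrite distrC -ler_sqr ?nnegrE ?(ltW eps0) // (real_normK (num_real _)).
  apply: le_trans le_V; rewrite /V /sqdev (bigD1 i) //= lerDl.
  by apply: sumr_ge0 => j _; exact: sqr_ge0.
have mean_cvg := tree_mean_cvg0 p01 V0 c0 halpha_pos alpha_div e0 e_sum descent.
rewrite (_ : (fun k => _) = fun k => (tree_mean p k V)%:E).
  by apply: cvg_EFin => //; apply: nearW.
apply/funext => k; rewrite -(expectation_history p01 hU_unif hU_ind k V0).
by congr expectation; apply/funext => w; rewrite yE.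
Qed.
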